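(* Let $N \in \mathbb{N}$, let $\mathbb{K}$ be a field, let $f \in \mathbb{K}[X_1, \ldots, X_N]$, and let $a_1, \ldots, a_N \in \mathbb{K} \setminus \{0\}$. Let $Q := \{a_1, 0\} \times \cdots \times \{a_N, 0\}$. Suppose that $f$ is absorbing at $(a_1, \ldots, a_N)$ for $Q$, and that $f(0, \ldots, 0) \neq 0$. Then $M(f) \ge 2^N$.
   Context: $\mathbb{N}$ denotes the set of positive integers. $M(f)$ denotes the number of monomials that appear in $f$ with nonzero coefficient. For $\mathbf{a} = (a_1,\ldots,a_N) \in Q$, the polynomial $f$ is called absorbing at $\mathbf{a}$ for $Q$ if for all $(x_1,\ldots,x_N) \in Q$: if there is $i \in \{1,\ldots,N\}$ with $x_i = a_i$, then $f(x_1,\ldots,x_N) = 0$. *)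

(* Defs.v *)
From mathcomp Require Import all_boot all_order all_algebra.
From mathcomp Require Import mpoly.

Set Implicit Arguments.
Unset Strict Implicit.
Unset Printing Implicit Defensive.

Import GRing.Theory.
Local Open Scope ring_scope.

Definition num_monomials (N : nat) (K : fieldType) (f : {mpoly K[N]}) : nat :=
  size (msupp f).

Definition grid (N : nat) (K : fieldType) (a : 'I_N -> K) (x : 'I_N -> K) : Prop :=
  forall i : 'I_N, x i \in [:: a i; 0].

(* The first conjunct records that the notion only makes sense at points of Q. *)
Definition absorbing_at (N : nat) (K : fieldType) (f : {mpoly K[N]})
    (Q : ('I_N -> K) -> Prop) (a : 'I_N -> K) : Prop :=
  Q a /\
  forall x : 'I_N -> K, Q x -> (exists i : 'I_N, x i = a i) -> f.@[x] = 0.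

(* Main.v *)
Require Import Defs.
From mathcomp Require Import all_boot all_order all_algebra.
From mathcomp Require Import mpoly.

Import GRing.Theory.
Local Open Scope ring_scope.

(** For [U : {set 'I_N}], weight the vertex of [Q] whose nonzero coordinates
    are those in [S] by [(-1)^#|S|] if [S \subset U] and by [0] otherwise.
    The weighted sum of the values of [f] is [f(0) != 0], since [f] vanishes at
    all other vertices.  On a monomial [m] the same sum factors as
    [\prod_i (0 ^+ m i - (i \in U) * a i ^+ m i)], which is zero unless [m]
    involves exactly the variables in [U].  So each [U] is the variable set
    of some monomial of [f]. *)

Definition vertex {N : nat} {K : fieldType} (a : 'I_N -> K) (S : {set 'I_N}) :
    'I_N -> K :=
  fun i => if i \in S then a i else 0.

Definition mvars {N : nat} (m : 'X_{1..N}) : {set 'I_N} := [set i | m i != 0%N].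

Lemma alternating_sum_monomial {N : nat} {K : fieldType} (a : 'I_N -> K)
    (U : {set 'I_N}) (m : 'X_{1..N}) :
  \sum_(S : {set 'I_N}) (\prod_(i in S) - (i \in U)%:R) *
    (\prod_i vertex a S i ^+ m i) =
  \prod_i (- (i \in U)%:R * a i ^+ m i + 0 ^+ m i) :> K.
Proof.
(* Expanding the right-hand product, [S] collects the indices where the first summand is chosen. *)
rewrite bigA_distr; apply: eq_bigr => S _.
rewrite big_mkcond -big_split; apply: eq_bigr => i _ /=.
by rewrite /vertex; case: (i \in S); rewrite ?mul1r.
Qed.

Lemma alternating_sum_monomial_eq0 {N : nat} {K : fieldType} (a : 'I_N -> K)
    (U : {set 'I_N}) (m : 'X_{1..N}) :
  mvars m != U ->
  \prod_i (- (i \in U)%:R * a i ^+ m i + 0 ^+ m i) = 0 :> K.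
Proof.
move=> neqU.
have /existsP[i] : [exists i, (i \in mvars m) != (i \in U)].
  rewrite -negb_forall; apply: contra neqU => /forallP eqU.
  by apply/eqP/setP => i; apply/eqP.
rewrite (bigD1 i) //= inE.
(* Since [0 ^+ 0 = 1], the factor at [i] is [-1 + 1] if [i] lies only in [U], and [0 + 0] if only in
   [mvars m]. *)
have [->|mi_neq0] := eqVneq (m i) 0%N; case: (i \in U) => //= _.
  by rewrite !expr0 mulr1 addNr mul0r.
by rewrite oppr0 mul0r add0r expr0n (negbTE mi_neq0) mul0r.
Qed.

Lemma absorbing_monomial_with_vars {N : nat} {K : fieldType}
    (f : {mpoly K[N]}) (a : 'I_N -> K) (U : {set 'I_N}) :
  absorbing_at f (grid a) a -> f.@[fun _ : 'I_N => 0] != 0 ->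
  U \in map mvars (msupp f).
Proof.
move=> [_ fQ0]; apply: contraNT => /mapP U_notin; apply/eqP.
have -> : f.@[fun _ : 'I_N => 0] =
    \sum_(S : {set 'I_N}) (\prod_(i in S) - (i \in U)%:R) * f.@[vertex a S].
  rewrite (bigD1 set0) //= big_set0 mul1r big1 ?addr0 => [|S].
    by apply: meval_eq => i; rewrite /vertex inE.
  case/set0Pn => j Sj; rewrite fQ0 ?mulr0 //.
    by move=> i; rewrite /vertex !inE; case: ifP; rewrite eqxx ?orbT.
  by exists j; rewrite /vertex Sj.
under eq_bigr => S _ do rewrite mevalE mulr_sumr.
rewrite exchange_big /= big_seq big1 // => m fm.
under eq_bigr => S _ do rewrite mulrCA.
rewrite -mulr_sumr alternating_sum_monomial alternating_sum_monomial_eq0 ?mulr0 //.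
by apply/eqP => eqU; apply: U_notin; exists m.
Qed.

Theorem theorem6p1 (N : nat) (hN : (0 < N)%N) (K : fieldType)
    (f : {mpoly K[N]}) (a : 'I_N -> K) (ha : forall i : 'I_N, a i != 0)
    (habs : absorbing_at f (grid a) a)
    (hf0 : f.@[fun _ : 'I_N => 0] != 0) :
  (2 ^ N <= num_monomials f)%N.
Proof.
have -> : (2 ^ N = size (enum {set 'I_N}))%N.
  by rewrite -cardE -cardsT -powersetT card_powerset cardsT card_ord.
(* Monomials may share a variable set, so [map mvars] may repeat entries; it suffices that it
   contains every subset. *)
rewrite /num_monomials -(size_map mvars); apply: uniq_leq_size (enum_uniq _) _.
by move=> U _; apply: absorbing_monomial_with_vars habs hf0.
Qed.
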